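(* Let $d\ge1$, let $\mathbf X_0$ be a random vector in $\mathbb R^d$ having a density with respect to Lebesgue measure, and let $r\in[2,\infty)$. If $\mathbf z$ and $\mathbf m$ are any deterministic vectors in $\mathbb R^d$, then $$\|\mathbf z\|^r\,[1-d_{\mathrm{TV}}(\mathbf X_0,\mathbf X_0+\mathbf z)]<2^{r-1}\,\mathbb E\|\mathbf X_0-\mathbf m\|^r.$$ Furthermore, for any nonzero $\mathbf c\in\mathbb R^d$ and $m\in\mathbb R$, $$|\langle\mathbf c,\mathbf z\rangle|^r\,[1-d_{\mathrm{TV}}(\mathbf X_0,\mathbf X_0+\mathbf z)]<2^{r-1}\,\mathbb E|\langle\mathbf c,\mathbf X_0\rangle-m|^r.$$
   Context: $\langle\cdot,\cdot\rangle$ and $\|\cdot\|$ are the Euclidean inner product and norm. $d_{\mathrm{TV}}(\mathbf Y,\tilde{\mathbf Y})$ denotes the total variation distance between the distributions of $\mathbf Y$ and $\tilde{\mathbf Y}$; if they have Lebesgue densities $f,\tilde f$ it equals $\frac12\int|f-\tilde f|\,d\mathbf x=1-\int\min\{f,\tilde f\}\,d\mathbf x$. The right-hand sides are allowed to be $+\infty$. *)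

(* Defs.v *)
From HB Require Import structures.
From mathcomp Require Import all_boot all_order all_algebra.
From mathcomp Require Import all_classical all_reals all_analysis.
Import Order.TTheory GRing.Theory Num.Theory.
Import numFieldNormedType.Exports.

Set Implicit Arguments.
Unset Strict Implicit.
Unset Printing Implicit Defensive.

Local Open Scope classical_set_scope.
Local Open Scope ring_scope.

(* R^n is 'rV[R]_n with the sigma-algebra generated by the n coordinates,
   that is, the product of n copies of the Borel sigma-algebra of R, which is
   the Borel sigma-algebra of R^n. *)
Definition measure_rV_display : measure_display.
Proof. exact: default_measure_display. Qed.

Section measurable_rV.
Context {R : realType}.
Variable n : nat.

Let coords : 'I_n -> 'rV[R]_n -> R := fun i x => x ord0 i.

Let rV_set0 : g_sigma_preimage coords set0.
Proof. exact: sigma_algebra0. Qed.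

Let rV_setC A : g_sigma_preimage coords A -> g_sigma_preimage coords (~` A).
Proof. exact: sigma_algebraC. Qed.

Let rV_bigcup (F : _^nat) : (forall i, g_sigma_preimage coords (F i)) ->
  g_sigma_preimage coords (\bigcup_i (F i)).
Proof. exact: sigma_algebra_bigcup. Qed.

HB.instance Definition _ := @isMeasurable.Build measure_rV_display
  'rV[R]_n (g_sigma_preimage coords) rV_set0 rV_setC rV_bigcup.

End measurable_rV.

Lemma measurable_coord (R : realType) n (i : 'I_n) :
  measurable_fun [set: 'rV[R]_n] (fun x => x ord0 i).
Proof.
move=> _ Y mY; rewrite setTI; apply: sub_sigma_algebra => /=.
rewrite -bigcup_seq/=; exists i => /=; first by rewrite mem_index_enum.
by exists Y => //; rewrite setTI.
Qed.

Lemma measurable_fun_rVP d (T : measurableType d) (R : realType) n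
    (f : T -> 'rV[R]_n) :
  measurable_fun [set: T] f <->
  forall i, measurable_fun [set: T] (fun w => f w ord0 i).
Proof.
split=> [mf i|mf].
  exact: (measurableT_comp (@measurable_coord R n i) mf).
move=> _ A; rewrite setTI => mA.
pose C := [set B : set 'rV[R]_n | measurable (f @^-1` B)].
suff : C A by [].
move: A mA; apply: smallest_sub.
  split => /=.
  - by rewrite /C /= preimage_set0.
  - by move=> A CA; rewrite /C /= setTD preimage_setC; exact: measurableC.
  - move=> F CF; rewrite /C /= preimage_bigcup.
    by apply: bigcupT_measurable => k; exact: CF.
rewrite -bigcup_seq => B [i _] /= [Y mY <-].
by rewrite /C /= setTI -[X in measurable X]setTI; exact: mf.
Qed.

Definition rV_cons (R : realType) n (x : R) (v : 'rV[R]_n) : 'rV[R]_n.+1 :=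
  row_mx x%:M v.

Lemma rV_cons0 (R : realType) n (x : R) (v : 'rV[R]_n) :
  rV_cons x v ord0 ord0 = x.
Proof.
rewrite /rV_cons (_ : ord0 = lshift n (ord0 : 'I_1)); last exact/val_inj.
by rewrite (row_mxEl (x%:M : 'M[R]_1)) mxE eqxx mulr1n.
Qed.

Lemma rV_consS (R : realType) n (x : R) (v : 'rV[R]_n) (i : 'I_n) :
  rV_cons x v ord0 (lift ord0 i) = v ord0 i.
Proof.
rewrite /rV_cons (_ : lift ord0 i = rshift 1 i); last exact/val_inj.
exact: (row_mxEr (x%:M : 'M[R]_1)).
Qed.

(* Lebesgue measure on R^n, by slicing along the first coordinate (iterated
   product of the one-dimensional Lebesgue measure); see lebesgue_rV_box. *)
Fixpoint lebesgue_rV (R : realType) (n : nat) : set 'rV[R]_n -> \bar R :=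
  match n with
  | 0 => fun A => \d_(0 : 'rV[R]_0) A
  | n'.+1 => fun A =>
      (\int[lebesgue_measure]_x lebesgue_rV [set v | A (rV_cons x v)])%E
  end.
Arguments lebesgue_rV {R n} A : rename.

Section lebesgue_rV_measure.
Context {R : realType}.

Lemma measurable_rV_cons n :
  measurable_fun [set: measurableTypeR R * 'rV[R]_n]
    (fun p => rV_cons p.1 p.2).
Proof.
apply/measurable_fun_rVP => i.
have [j ->|->] := unliftP ord0 i.
  under eq_fun do rewrite rV_consS.
  exact: (measurableT_comp (@measurable_coord R n j) measurable_snd).
under eq_fun do rewrite rV_cons0.
exact: measurable_fst.
Qed.


End lebesgue_rV_measure.

Section lebesgue_rV_step.
Context {R : realType} (n : nat).
Variable mu : {sigma_finite_measure set 'rV[R]_n -> \bar R}.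

Let cons_pair (p : measurableTypeR R * 'rV[R]_n) : 'rV[R]_n.+1 :=
  rV_cons p.1 p.2.

Let step (A : set 'rV[R]_n.+1) : \bar R :=
  (\int[@lebesgue_measure R]_x mu [set v | A (rV_cons x v)])%E.

Let stepE A : step A = ((@lebesgue_measure R \x mu) (cons_pair @^-1` A))%E.
Proof.
apply: eq_integral => x _ /=; congr (mu _).
by apply/seteqP; split => v; rewrite /xsection /= inE.
Qed.

Let mcons A : measurable A -> measurable (cons_pair @^-1` A).
Proof. by move=> mA; rewrite -[X in measurable X]setTI; exact: measurable_rV_cons. Qed.

Let step0 : step set0 = 0%E.
Proof. by rewrite stepE preimage_set0 measure0. Qed.

Let step_ge0 A : (0 <= step A)%E.
Proof. by rewrite stepE measure_ge0. Qed.

Let step_sigma_additive : semi_sigma_additive step.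
Proof.
move=> F mF tF mUF; rewrite stepE (_ : (fun _ => _) = fun k =>
  (\sum_(0 <= i < k) (@lebesgue_measure R \x mu) (cons_pair @^-1` F i))%E).
  rewrite preimage_bigcup; apply: measure_semi_sigma_additive.
  - by move=> i; exact: mcons.
  - apply/trivIsetP => /= i j _ _ ij; rewrite -preimage_setI.
    by move/trivIsetP : tF => /(_ _ _ _ _ ij) ->//; rewrite preimage_set0.
  - by rewrite -preimage_bigcup; exact: mcons.
by apply/funext => k; apply: eq_bigr => i _; rewrite stepE.
Qed.

HB.instance Definition _ := isMeasure.Build _ _ _ step
  step0 step_ge0 step_sigma_additive.

Let step_box (A : set (measurableTypeR R)) (B : set 'rV[R]_n) :
  measurable A -> measurable B ->
  let C := [set x : 'rV[R]_n.+1 | A (x ord0 ord0) /\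
                         B (\row_i x ord0 (lift ord0 i))] in
  measurable C /\ step C = (lebesgue_measure A * mu B)%E.
Proof.
move=> mA mB C; split.
  apply: measurableI.
    rewrite -[X in measurable X]setTI; exact: measurable_coord.
  rewrite -[X in measurable X]setTI.
  suff : measurable_fun setT
    (fun x : 'rV[R]_n.+1 => \row_(i < n) x ord0 (lift ord0 i)) by exact.
  apply/measurable_fun_rVP => i; under eq_fun do rewrite mxE.
  exact: measurable_coord.
rewrite stepE -product_measure1E//; congr (product_measure1 _ _ _).
apply/seteqP; split => -[x v]; rewrite /C /cons_pair /=.
  rewrite rV_cons0 => -[Ax]; rewrite (_ : \row_i _ = v)//.
  by apply/rowP => i; rewrite mxE rV_consS.
move=> [Ax Bv]; rewrite rV_cons0; split => //.
rewrite (_ : \row_i _ = v)//.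
by apply/rowP => i; rewrite mxE rV_consS.
Qed.

Let step_sigma_finite : sigma_finite setT step.
Proof.
have /sigma_finiteP[F [TF ndF Foo]] := sigma_finiteT (@lebesgue_measure R).
have /sigma_finiteP[G [TG ndG Goo]] := sigma_finiteT mu.
exists (fun k => [set x : 'rV[R]_n.+1 | F k (x ord0 ord0) /\
                         G k (\row_i x ord0 (lift ord0 i))]).
  apply/seteqP; split => // x _.
  have [k _ Fk] : (\bigcup_k F k) (x ord0 ord0) by rewrite -TF.
  have [l _ Gl] : (\bigcup_k G k) (\row_i x ord0 (lift ord0 i)) by rewrite -TG.
  exists (maxn k l) => //; split.
  - by move: Fk; exact/subsetPset/ndF/leq_maxl.
  - by move: Gl; exact/subsetPset/ndG/leq_maxr.
move=> k; have [mF Fk] := Foo k; have [mG Gk] := Goo k.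
have [mC ->] := step_box mF mG; split => //.
by rewrite lte_mul_pinfty// ge0_fin_numE.
Qed.

HB.instance Definition _ := Measure_isSigmaFinite.Build _ _ _ step
  step_sigma_finite.

Lemma lebesgue_rV_step :
  exists nu : {sigma_finite_measure set 'rV[R]_n.+1 -> \bar R},
  (forall A, nu A = \int[lebesgue_measure]_x mu [set v | A (rV_cons x v)])%E /\
  forall (A : set R) (B : set 'rV[R]_n), measurable A -> measurable B ->
    nu [set x | A (x ord0 ord0) /\ B (\row_i x ord0 (lift ord0 i))] =
    (lebesgue_measure A * mu B)%E.
Proof.
exists (step : {sigma_finite_measure set 'rV[R]_n.+1 -> \bar R}); split => //.
by move=> A B mA mB; have [] := step_box mA mB.
Qed.

End lebesgue_rV_step.

Section lebesgue_rV_instances.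
Context {R : realType}.

Lemma lebesgue_rV_is_sigma_finite_measure n :
  exists mu : {sigma_finite_measure set 'rV[R]_n -> \bar R},
    forall A, mu A = lebesgue_rV A.
Proof.
elim: n => [|n [mu muE]].
  by exists (\d_(0 : 'rV[R]_0) : {sigma_finite_measure set _ -> \bar R}).
have [nu [nuE _]] := lebesgue_rV_step mu.
exists nu => A; rewrite nuE /=; apply: eq_integral => x _; exact: muE.
Qed.

Variable n : nat.
Local Notation leb := (@lebesgue_rV R n).

Let lebesgue_rV0 : leb set0 = 0%E.
Proof.
by have [mu muE] := lebesgue_rV_is_sigma_finite_measure n; rewrite -muE measure0.
Qed.

Let lebesgue_rV_ge0 A : (0 <= leb A)%E.
Proof.
by have [mu muE] := lebesgue_rV_is_sigma_finite_measure n; rewrite -muE measure_ge0.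
Qed.

Let lebesgue_rV_sigma_additive : semi_sigma_additive leb.
Proof.
have [mu /funext <-] := lebesgue_rV_is_sigma_finite_measure n.
exact: measure_semi_sigma_additive.
Qed.

HB.instance Definition _ := isMeasure.Build _ _ _ leb
  lebesgue_rV0 lebesgue_rV_ge0 lebesgue_rV_sigma_additive.

Let lebesgue_rV_sigma_finite : sigma_finite setT leb.
Proof.
have [mu /funext <-] := lebesgue_rV_is_sigma_finite_measure n.
exact: sigma_finiteT.
Qed.

HB.instance Definition _ := Measure_isSigmaFinite.Build _ _ _ leb
  lebesgue_rV_sigma_finite.

End lebesgue_rV_instances.

(* By uniqueness of sigma-finite measures on measurable boxes, this property
   characterizes Lebesgue measure on R^n. *)
Lemma lebesgue_rV_box (R : realType) n (A : 'I_n -> set R) :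
  (forall i, measurable (A i)) ->
  lebesgue_rV [set x : 'rV[R]_n | forall i, A i (x ord0 i)] =
  (\prod_(i < n) lebesgue_measure (A i))%E.
Proof.
elim: n A => [A mA|n IHn A mA].
  by rewrite big_ord0 /= diracE mem_set// => -[].
rewrite big_ord_recl -IHn//.
have [nu [nuE nu_box]] := lebesgue_rV_step (@lebesgue_rV R n).
rewrite -nu_box//; last first.
  rewrite (_ : [set _ | _] =
      \big[setI/setT]_(i < n) [set x : 'rV[R]_n | A (lift ord0 i) (x ord0 i)]).
    apply: bigsetI_measurable => i _.
    by rewrite -[X in measurable X]setTI; exact: measurable_coord.
  rewrite -bigcap_seq; apply/seteqP; split => x /= Ax i; first by move=> _.
  by apply: Ax; rewrite /= mem_index_enum.
rewrite nuE /=; congr (integral _ _ _); apply/funext => x; congr lebesgue_rV.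
apply/seteqP; split => v /= Av.
  split; first exact: Av.
  by move=> i; rewrite mxE; exact: Av.
by move=> i; have [j ->|->] := unliftP ord0 i; [have := Av.2 j; rewrite mxE|case: Av].
Qed.

Definition has_density (R : realType) n (mu : set 'rV[R]_n -> \bar R) :=
  exists f : 'rV[R]_n -> R,
    [/\ measurable_fun [set: 'rV[R]_n] f,
        (forall x, 0 <= f x) &
        forall A, measurable A -> mu A = (\int[lebesgue_rV]_(x in A) (f x)%:E)%E].

(* Total variation distance normalized to take values in [0, 1]. *)
Definition tv_dist d (T : measurableType d) (R : realType)
    (mu nu : probability T R) : R :=
  sup [set `|fine (mu A) - fine (nu A)| | A in measurable].

Definition dotr (R : realType) n (u v : 'rV[R]_n) : R :=
  \sum_(i < n) u ord0 i * v ord0 i.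

(* The library's `|u| is the maximum norm on 'rV[R]_n. *)
Definition enorm (R : realType) n (u : 'rV[R]_n) : R := Num.sqrt (dotr u u).

Definition shift_rV d (T : measurableType d) (R : realType) n
    (X : T -> 'rV[R]_n) (z : 'rV[R]_n) : T -> 'rV[R]_n := fun w => X w + z.

Section shift_rV_measurable.
Context d (T : measurableType d) (R : realType) (n : nat).
Variables (X : {mfun T >-> 'rV[R]_n}) (z : 'rV[R]_n).

Let measurable_shift_rV : measurable_fun [set: T] (shift_rV X z).
Proof.
apply/measurable_fun_rVP => i; under eq_fun do rewrite mxE.
apply: measurable_realfun.measurable_funD => //; apply/(measurable_fun_rVP X).1.
exact: measurable_funPT.
Qed.

HB.instance Definition _ := isMeasurableFun.Build _ _ _ _ (shift_rV X z)
  measurable_shift_rV.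

End shift_rV_measurable.

(* Main.v *)
Require Import Defs.
From mathcomp Require Import all_boot all_order all_algebra.
From mathcomp Require Import all_classical all_reals all_analysis.
From mathcomp Require Import measurable_realfun ring lra.
Import Order.TTheory GRing.Theory Num.Theory.
Import numFieldNormedType.Exports.

Set Implicit Arguments.
Unset Strict Implicit.
Unset Printing Implicit Defensive.

Local Open Scope classical_set_scope.
Local Open Scope ring_scope.

(** Write [a = dotr c z] and suppose [a != 0].  The law of [X0] and the law of
    [X0 + z] enter only through the real variable [V = (dotr c X0 - m) / a],
    which the translation by [z] turns into [V + 1].

    The overlap [1 - tv_dist mu nu] is the infimum of the integrals
    [\int f dmu + \int g dnu] over nonnegative [f], [g] with [f + g >= 1]: for
    densities [p], [q] this is just [min p q <= f p + g q].  So a bound comes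
    from a good choice of [f] and [g].  Take
    [f = phi V] and [g = phi (1 - V)], where [phi v = (2 v^+)^r / 2] is one
    half of the even function [2^(r-1) |v|^r].  Two facts make it work:
    - [phi u + phi (1 - u) > 1] except at [u = 1/2].  For [u] in [0, 1] this is
      the strict convexity of the power; outside, one term alone exceeds [1];
    - after the translation [1 - V] becomes [- V], and
      [phi V + phi (- V) = 2^(r-1) |V|^r], so that the two integrals add up to
      the moment on the right-hand side, with the constant [2^(r-1)].

    The inequality is strict because the exceptional set is a hyperplane, which
    is null for a law with a density.  The overlap itself is handled by a
    Hahn decomposition of [mu - nu], whose two parts are where [q <= p] and
    where [p <= q].

    If [a = 0], the left-hand side vanishes and the moment is positive, again
    because hyperplanes are null.  Finally, the inequality for [enorm z] is the
    one for a unit vector [c] along [z], since [|dotr c x| <= enorm x]. *)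

(** * Weights bounding the overlap of two probability measures *)

Section integral_bounds.
Context (dT : measure_display) (T : measurableType dT) (R : realType).

(** Comparison of integrals over a set on whose subsets one measure dominates
    the other; this localizes the comparison to each half of a Hahn
    decomposition. *)
Lemma ge0_le_integral_on (mu nu : {measure set T -> \bar R}) (D : set T)
    (f : T -> \bar R) :
  measurable D ->
  (forall A, measurable A -> A `<=` D -> (mu A <= nu A)%E) ->
  (forall x, (0 <= f x)%E) -> measurable_fun [set: T] f ->
  (\int[mu]_(x in D) f x <= \int[nu]_(x in D) f x)%E.
Proof.
move=> mD munu f0 mf.
have restrE (m : {measure set T -> \bar R}) :
    (\int[m]_(x in D) f x = \int[mrestr m mD]_(x in D) f x)%E.
  apply: eq_measure_integral => A mA AD.
  by rewrite /= /mrestr setIidl.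
rewrite (restrE mu) (restrE nu); apply: ge0_le_measure_integral => // A mA.
by apply: munu; [exact: measurableI|exact: subIsetr].
Qed.

(** The excess of [h] over [1] is a.e. positive, so its integral over a set that
    is not null cannot vanish. *)
Lemma measure_lt_integral (mu : {finite_measure set T -> \bar R}) (D : set T)
    (h : T -> R) :
  measurable D -> measurable_fun [set: T] h ->
  (forall x, 0 <= h x) -> {ae mu, forall x, 1 < h x} ->
  mu D != 0%E -> (mu D < \int[mu]_(x in D) (h x)%:E)%E.
Proof.
move=> mD mh h0 h1 muD0.
pose k x := Num.max (h x - 1) 0.
have mk : measurable_fun [set: T] k.
  by apply: measurable_maxr => //; exact: measurable_funB.
have mkD : measurable_fun D (EFin \o k).
  by apply/measurable_EFinP; exact: measurable_funS mk.
have k0 x : 0 <= k x by rewrite le_max lexx orbT.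
apply: (@lt_le_trans _ _ (\int[mu]_(x in D) (1 + (k x)%:E))%E); last first.
  apply: ae_ge0_le_integral => //.
  - by move=> x _; rewrite adde_ge0// lee_fin.
  - by apply: emeasurable_funD => //.
  - by move=> x _; rewrite lee_fin.
  - by apply/measurable_EFinP; exact: measurable_funS mh.
  - apply: filterS h1 => x hx _; rewrite -EFinD lee_fin /k max_l; lra.
rewrite ge0_integralD//; last by move=> x _; rewrite lee_fin.
rewrite integral_cst// mul1e lteDl ?fin_num_measure//.
rewrite lt0e integral_ge0 ?andbT; last by move=> x _; rewrite lee_fin.
apply: contraNneq muD0 => intk0; apply/eqP.
have : ae_eq mu D (EFin \o k) (cst 0%E).
  apply/ae_eq_integral_abs => //; rewrite -{}[RHS]intk0.
  by apply: eq_integral => x _; rewrite gee0_abs// lee_fin.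
move=> kD0; apply: measure_negligible => //.
apply: negligibleS (_ : mu.-negligible (~` [set x | ~ D x])).
  by move=> x Dx /=; apply.
apply: filterS2 kD0 h1 => x /= kx hx Dx.
have [] := kx Dx; rewrite /k max_l; lra.
Qed.

(** Let [A], [B] be the parts where [mu] exceeds [nu] and conversely.  Then
    [1 - tv_dist mu nu <= mu B + nu A], and replacing [nu] by the smaller [mu]
    on [B], and [mu] by the smaller [nu] on [A], bounds the two integrals below
    by the integral of [f + g] against [mu] on [B] and [nu] on [A].  The
    positivity assumption is for mutually singular [mu] and [nu], where
    [mu B + nu A = 0] and no strictness is gained from [f + g > 1]. *)
Lemma tv_dist_lt (mu nu : probability T R) (f g : T -> R) :
  measurable_fun [set: T] f -> measurable_fun [set: T] g ->
  (forall x, 0 <= f x) -> (forall x, 0 <= g x) ->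
  {ae mu, forall x, 1 < f x + g x} -> {ae nu, forall x, 1 < f x + g x} ->
  (0 < \int[mu]_x (f x)%:E + \int[nu]_x (g x)%:E)%E ->
  ((1 - tv_dist mu nu)%:E < \int[mu]_x (f x)%:E + \int[nu]_x (g x)%:E)%E.
Proof.
move=> mf mg f0 g0 fg1 fg2 int_gt0.
pose sigma := cadd (charge_of_finite_measure mu)
  (copp (charge_of_finite_measure nu)).
have [A [B [[mA posA] [mB negB] AB AB0]]] := Hahn_decomposition sigma.
have nuleA C : measurable C -> C `<=` A -> (nu C <= mu C)%E.
  move=> mC CA; rewrite -sube_ge0 ?fin_num_measure//.
  exact: posA.
have muleB C : measurable C -> C `<=` B -> (mu C <= nu C)%E.
  move=> mC CB; rewrite -sube_le0 ?fin_num_measure//.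
  exact: negB.
have BE : B = ~` A.
  apply/seteqP; split => x.
    by move=> Bx Ax; have : set0 x by rewrite -AB0.
  by move=> nAx; have : setT x by []; rewrite -AB => -[].
(* The set A is a competitor in the supremum defining the distance. *)
have tvle : ((1 - tv_dist mu nu)%:E <= mu B + nu A)%E.
  rewrite BE probability_setC// -(@fineK _ (mu A)) ?fin_num_measure//.
  rewrite -(@fineK _ (nu A)) ?fin_num_measure// -EFinB -EFinD lee_fin.
  suff : fine (mu A) - fine (nu A) <= tv_dist mu nu by lra.
  apply: le_trans (ler_norm _) _; apply: ub_le_sup; last by exists A.
  exists 1 => _ [C mC <-]; rewrite ler_norml.
  have hC (m : probability T R) : 0 <= fine (m C) <= 1.
    rewrite fine_ge0//= -lee_fin fineK ?fin_num_measure//.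
    exact: probability_le1.
  have := hC mu; have := hC nu; lra.
have mfE D : measurable_fun D (EFin \o f).
  by apply/measurable_EFinP; exact: measurable_funS mf.
have mgE D : measurable_fun D (EFin \o g).
  by apply/measurable_EFinP; exact: measurable_funS mg.
have f0E x : (0 <= (f x)%:E)%E by rewrite lee_fin.
have g0E x : (0 <= (g x)%:E)%E by rewrite lee_fin.
have [/andP[/eqP muB0 /eqP nuA0]|] := boolP ((mu B == 0%E) && (nu A == 0%E)).
  by apply: le_lt_trans tvle _; rewrite muB0 nuA0 adde0.
rewrite negb_and => nondeg.
have dAB : [disjoint A & B] by apply/disj_set2P.
have sum_ge : (\int[mu]_(x in B) (f x + g x)%:E +
               \int[nu]_(x in A) (f x + g x)%:E <=
    \int[mu]_x (f x)%:E + \int[nu]_x (g x)%:E)%E.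
  have splitE (m : probability T R) D : measurable D ->
      (\int[m]_(x in D) (f x + g x)%:E =
       \int[m]_(x in D) (f x)%:E + \int[m]_(x in D) (g x)%:E)%E.
    by move=> mD; under eq_integral do rewrite EFinD; rewrite ge0_integralD.
  have setAB (m : probability T R) (h : T -> R) :
      measurable_fun [set: T] h -> (forall x, 0 <= h x) ->
      (\int[m]_x (h x)%:E =
       \int[m]_(x in A) (h x)%:E + \int[m]_(x in B) (h x)%:E)%E.
    move=> mh h0; rewrite -AB ge0_integral_setU//.
      by apply/measurable_EFinP; exact: measurable_funS mh.
    by move=> x _; rewrite lee_fin.
  rewrite !splitE// !setAB// addeACA leeD// [leRHS]addeC.
    by rewrite leeD2l// ge0_le_integral_on//; exact: mfE.
  by rewrite leeD2r// ge0_le_integral_on//; exact: mgE.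
apply: le_lt_trans tvle _; apply: lt_le_trans sum_ge.
have mfg : measurable_fun [set: T] (fun x => f x + g x).
  exact: measurable_funD.
have fg0 x : 0 <= f x + g x by rewrite addr_ge0.
have lt_int (m : probability T R) D : measurable D ->
    {ae m, forall x, 1 < f x + g x} -> m D != 0%E ->
    (m D < \int[m]_(x in D) (f x + g x)%:E)%E.
  by move=> mD hm mD0; apply: measure_lt_integral.
have le_int (m : probability T R) D : measurable D ->
    {ae m, forall x, 1 < f x + g x} ->
    (m D <= \int[m]_(x in D) (f x + g x)%:E)%E.
  move=> mD hm; have [->|mD0] := eqVneq (m D) 0%E; last exact/ltW/lt_int.
  by apply: integral_ge0 => x _; rewrite lee_fin.
case/orP: nondeg => [muB0|nuA0].
  by apply: lte_leD; [exact: fin_num_measure|exact: lt_int|exact: le_int].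
rewrite (addeC (mu B)) [X in (_ < X)%E]addeC.
by apply: lte_leD; [exact: fin_num_measure|exact: lt_int|exact: le_int].
Qed.

End integral_bounds.

(** * One half of the even power function *)

Section half_power.
Context (R : realType) (r : R).

(** This is [(2 v^+)^r / 2]: the branch over the positive half-line of
    [2^(r-1) |v|^r].  The truncation by [Num.max] also avoids powers of negative
    bases. *)
Definition half_power (v : R) : R := 2 `^ (r - 1) * Num.max v 0 `^ r.

Lemma half_power_ge0 v : 0 <= half_power v.
Proof. by rewrite mulr_ge0 ?powR_ge0. Qed.

Lemma measurable_half_power : measurable_fun [set: R] half_power.
Proof.
apply: measurable_funM => //.
apply: (measurableT_comp (measurable_powR r)).
exact: measurable_maxr.
Qed.

Lemma half_powerDN v : r != 0 ->
  half_power v + half_power (- v) = 2 `^ (r - 1) * `|v| `^ r.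
Proof.
move=> r0; rewrite /half_power -mulrDr; congr (_ * _).
have [v0|v0] := lerP 0 v.
  by rewrite max_r ?oppr_le0// powR0// addr0 ger0_norm.
by rewrite max_l ?oppr_ge0 ?(ltW v0)// powR0// add0r ltr0_norm.
Qed.

Let pow1R (p : R) : 1 `^ p = 1 :> R.
Proof. by rewrite powR1. Qed.

(** Strict convexity at the midpoint.  Convexity of the power [r / 2 >= 1],
    applied to the squares, gives [(1 + t^2)^(r/2)] as a lower bound for the
    mean, and this makes the strictness visible. *)
Lemma powR_mean_gt1 (t : R) : 2 <= r -> -1 <= t <= 1 -> t != 0 ->
  2 < (1 + t) `^ r + (1 - t) `^ r.
Proof.
move=> r2 t1 t0.
have sqE (x : R) : 0 <= x -> x `^ r = (x ^+ 2) `^ (r / 2).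
  by move=> x0; rewrite -powR_mulrn// -powRrM; congr (_ `^ _); field.
rewrite !sqE; [|lra..].
have r21 : 1 <= r / 2 by lra.
have half0 : 0 <= (2^-1 : R) by lra.
have half1 : (2^-1 : R) <= 1 by lra.
have nneg (x : R) : x ^+ 2 \in (`[0, +oo[%classic : set R).
  by rewrite inE/= in_itv/= andbT sqr_ge0.
have := convex_powR r21 (Itv01 half0 half1) (nneg (1 + t)) (nneg (1 - t)).
rewrite convRE [X in X `^ _ <= _]convRE /= /unstable.onem.
have -> : 2^-1 * (1 + t) ^+ 2 + (1 - 2^-1) * (1 - t) ^+ 2 = 1 + t ^+ 2 :> R.
  by field.
have : 1 < (1 + t ^+ 2) `^ (r / 2).
  rewrite -[X in X < _](pow1R (r / 2)) gt0_ltr_powR ?nnegrE//; first lra.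
    by rewrite addr_ge0// sqr_ge0.
  by rewrite ltrDl exprn_even_gt0.
lra.
Qed.

(** At [u = 1/2] both terms are equal to [1/2].  In [0, 1] the substitution
    [t = 2 u - 1] reduces to [powR_mean_gt1]; outside, the argument of one of
    the two terms is at least [1]. *)
Lemma half_power_sum_gt1 (u : R) : 2 <= r -> u != 2^-1 ->
  1 < half_power u + half_power (1 - u).
Proof.
move=> r2 u2.
have r0 : 0 < r by lra.
have big (v : R) : 1 <= v -> 1 < half_power v.
  move=> v1; rewrite /half_power max_l; last lra.
  apply: (@lt_le_trans _ _ (2 `^ (r - 1))).
    rewrite -[X in X < _](pow1R (r - 1)) gt0_ltr_powR ?nnegrE//; lra.
  rewrite ler_peMr ?powR_ge0// -[X in X <= _](pow1R r).
  by rewrite ge0_ler_powR ?nnegrE//; lra.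
have := half_power_ge0 u; have := half_power_ge0 (1 - u).
have [u1|u1] := lerP 1 u; first by have := big _ u1; lra.
have [u0|u0] := lerP u 0.
  have : 1 <= 1 - u by lra.
  by move/big; lra.
move=> _ _; rewrite /half_power !max_l; [|lra..].
pose t := 2 * u - 1.
have t1 : -1 <= t <= 1 by rewrite /t; lra.
have t0 : t != 0 by apply: contra_neq u2; rewrite /t; lra.
have := powR_mean_gt1 r2 t1 t0.
rewrite (_ : 1 + t = 2 * u); last by rewrite /t; ring.
rewrite (_ : 1 - t = 2 * (1 - u)); last by rewrite /t; ring.
rewrite !powRM ?ler0n//; [|lra..].
have -> : 2 `^ r = 2 * 2 `^ (r - 1) :> R.
  rewrite -[in X in X * _](powRr1 (ler0n R 2)) -powRD.
    by congr (_ `^ _); ring.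
  by apply/implyP; rewrite pnatr_eq0.
rewrite -!mulrA; lra.
Qed.

End half_power.

(** * Dot product and hyperplanes *)

Section dot_product.
Context (R : realType) (n : nat).
Implicit Types u v w : 'rV[R]_n.

Lemma dotrC u v : dotr u v = dotr v u.
Proof. by apply: eq_bigr => i _; rewrite mulrC. Qed.

Lemma dotrDr u v w : dotr u (v + w) = dotr u v + dotr u w.
Proof. by rewrite -big_split; apply: eq_bigr => i _; rewrite mxE mulrDr. Qed.

Lemma dotrZr (a : R) u v : dotr u (a *: v) = a * dotr u v.
Proof. by rewrite mulr_sumr; apply: eq_bigr => i _; rewrite mxE mulrCA. Qed.

Lemma dotrZl (a : R) u v : dotr (a *: u) v = a * dotr u v.
Proof. by rewrite dotrC dotrZr dotrC. Qed.

Lemma dotr_ge0 u : 0 <= dotr u u.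
Proof. by apply: sumr_ge0 => i _; rewrite -expr2 sqr_ge0. Qed.

Lemma dotr_eq0 u : (dotr u u == 0) = (u == 0).
Proof.
apply/idP/eqP => [|->]; last by rewrite -(scale0r 0) dotrZr mul0r.
rewrite psumr_eq0 => [/allP u0|i _]; last by rewrite -expr2 sqr_ge0.
apply/rowP => i; rewrite mxE; apply/eqP.
by have := u0 i; rewrite mem_index_enum mulf_eq0 orbb; exact.
Qed.

(** Cauchy-Schwarz for a unit vector: the component of [v] orthogonal to [u] has
    a nonnegative square norm. *)
Lemma normr_dotr_unit u v : dotr u u = 1 -> `|dotr u v| <= enorm v.
Proof.
move=> u1; rewrite -sqrtr_sqr ler_sqrt ?dotr_ge0//.
have := dotr_ge0 (v + - dotr u v *: u).
rewrite dotrDr ![dotr (_ + _) _]dotrC !dotrDr !dotrZr !dotrZl u1 (dotrC v u).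
lra.
Qed.

Lemma measurable_dotr u : measurable_fun [set: 'rV[R]_n] (dotr u).
Proof.
apply: measurable_sum => i; apply: measurable_funM => //.
exact: measurable_coord.
Qed.

End dot_product.

(** The vector [z] normalized, or any unit vector if [z] is zero; the latter
    case requires a positive dimension. *)
Lemma unit_dotr_enorm (R : realType) n (z : 'rV[R]_n.+1) :
  exists c : 'rV[R]_n.+1, dotr c c = 1 /\ `|dotr c z| = enorm z.
Proof.
have [->|z0] := eqVneq z 0.
  exists (delta_mx 0 0); split.
    rewrite /dotr big_ord_recl !mxE eqxx mulr1 big1 ?addr0// => i _.
    by rewrite !mxE mulr0.
  by rewrite /enorm -(scale0r 0) !dotrZr !mul0r normr0 sqrtr0.
have z1 : enorm z != 0.
  by rewrite sqrtr_eq0 -ltNge lt_neqAle dotr_ge0 eq_sym dotr_eq0 z0.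
have zz : dotr z z = enorm z * enorm z by rewrite -expr2 sqr_sqrtr// dotr_ge0.
exists ((enorm z)^-1 *: z); rewrite dotrZr dotrZl zz mulKf//.
by split; [rewrite mulVf|rewrite ger0_norm ?sqrtr_ge0].
Qed.

(** Slicing along the first coordinate: if the other coefficients of [c] are not
    all zero, each slice is a hyperplane of one dimension less; otherwise only
    one slice is nonempty. *)
Lemma lebesgue_rV_hyperplane (R : realType) n (c : 'rV[R]_n) (t : R) :
  c != 0 -> lebesgue_rV [set x | dotr c x = t] = 0%E.
Proof.
elim: n c t => [c t|n IHn c t c0]; first by rewrite (thinmx0 c) eqxx.
pose c' : 'rV[R]_n := \row_i c ord0 (lift ord0 i).
have dotE x v : dotr c (rV_cons x v) = c ord0 ord0 * x + dotr c' v.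
  rewrite /dotr big_ord_recl rV_cons0; congr (_ + _).
  by apply: eq_bigr => i _; rewrite rV_consS mxE.
have sliceE x : [set v | [set y | dotr c y = t] (rV_cons x v)] =
    [set v | dotr c' v = t - c ord0 ord0 * x].
  by apply/seteqP; split => v /=; rewrite dotE; lra.
rewrite /=; under eq_integral do rewrite sliceE.
have [c'0|c'0] := eqVneq c' 0; last first.
  by under eq_integral do rewrite IHn//; rewrite integral0.
have c00 : c ord0 ord0 != 0.
  apply: contra_neq c0 => c00; apply/rowP => i; rewrite mxE.
  have [j ->|->//] := unliftP ord0 i.
  by have /rowP/(_ j) := c'0; rewrite !mxE.
pose F x := lebesgue_rV [set v | dotr c' v = t - c ord0 ord0 * x].
have -> : (fun x => F x) = F \_ [set t / c ord0 ord0].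
  apply/funext => x; rewrite patchE; case: ifPn => //.
  rewrite notin_setE /F /= => xt.
  rewrite (_ : [set v | _] = set0) ?measure0//.
  apply/seteqP; split => // v /=; rewrite c'0 dotrC -(scale0r 0) dotrZr mul0r.
  by move=> h; apply: xt; apply: (mulfI c00); rewrite mulrCA divff//; lra.
by rewrite -integral_mkcond integral_set1.
Qed.

Lemma measurable_hyperplane (R : realType) n (c : 'rV[R]_n) (t : R) :
  measurable [set x | dotr c x = t].
Proof.
rewrite -[X in measurable X]setTI.
exact: (measurable_dotr c measurableT (measurable_set1 t)).
Qed.

(** * Moments and overlap of a translated vector *)

Section shifted_vector.
Context (R : realType) (n : nat) (dO : measure_display).
Context (Omega : measurableType dO) (P : probability Omega R).
Variable X : {RV P >-> 'rV[R]_n}.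
Hypothesis X_density : has_density (distribution P X).

Lemma has_density_hyperplane (c : 'rV[R]_n) (t : R) :
  c != 0 -> P [set w | dotr c (X w) = t] = 0%E.
Proof.
move=> c0; have [f [mf f0 XE]] := X_density.
rewrite [LHS](XE _ (measurable_hyperplane c t)) null_set_integral//.
- exact: measurable_hyperplane.
- by apply/measurable_EFinP; exact: measurable_funS mf.
- exact: lebesgue_rV_hyperplane.
Qed.

Lemma measurable_dotr_RV (c : 'rV[R]_n) :
  measurable_fun [set: Omega] (fun w => dotr c (X w)).
Proof. by apply: measurableT_comp => //; exact: measurable_dotr. Qed.

Lemma measurable_moment (c : 'rV[R]_n) (m r : R) :
  measurable_fun [set: Omega] (fun w => `|dotr c (X w) - m| `^ r).
Proof.
apply: (measurableT_comp (measurable_powR r)).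
apply: measurableT_comp => //; apply: measurable_funB => //.
exact: measurable_dotr_RV.
Qed.

Lemma moment_dotr_gt0 (c : 'rV[R]_n) (m r : R) : c != 0 ->
  (0 < \int[P]_w (`|dotr c (X w) - m| `^ r)%:E)%E.
Proof.
move=> c0; rewrite lt0e integral_ge0 ?andbT; last first.
  by move=> w _; rewrite lee_fin powR_ge0.
apply/eqP => int0.
have mf := measurable_moment c m r.
have : ae_eq P [set: Omega] (fun w => (`|dotr c (X w) - m| `^ r)%:E) (cst 0%E).
  apply/ae_eq_integral_abs => //; first exact/measurable_EFinP.
  rewrite -{}[RHS]int0; apply: eq_integral => w _.
  by rewrite gee0_abs// lee_fin powR_ge0.
move=> ae0.
have [N [mN PN0 NE]] : P.-negligible (~` [set w | dotr c (X w) = m]).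
  apply: filterS ae0 => w /= /(_ I) [/eqP].
  by rewrite powR_eq0 normr_eq0 subr_eq0 => /andP[/eqP].
have mH : measurable [set w | dotr c (X w) = m].
  rewrite -[X in measurable X]setTI.
  exact: (measurable_dotr_RV c measurableT (measurable_set1 m)).
have := probability_setC P mH.
rewrite has_density_hyperplane// sube0 => PH.
have : (P (~` [set w | dotr c (X w) = m]) <= P N)%E.
  by apply: le_measure => //; rewrite inE//; exact: measurableC.
by rewrite PH PN0 lee_fin ler10.
Qed.

(** The inequality for one linear functional, obtained from [tv_dist_lt] with
    the weights [half_power r V] and [half_power r (1 - V)], where
    [V = (dotr c x - m) / dotr c z] grows by [1] under the translation. *)
Lemma tv_dist_shift_dotr_lt (z c : 'rV[R]_n) (m r : R) : 2 <= r -> c != 0 ->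
  ((`|dotr c z| `^ r
     * (1 - tv_dist (distribution P X) (distribution P (shift_rV X z))))%:E
  < (2 `^ (r - 1))%:E * 'E_P[fun w => (`|dotr c (X w) - m| `^ r)%R])%E.
Proof.
move=> r2 c0; rewrite unlock.
have r0 : r != 0 by lra.
have pow2 : 0 < 2 `^ (r - 1) :> R by rewrite powR_gt0.
set a := dotr c z.
have [->|a0] := eqVneq a 0.
  by rewrite normr0 powR0// mul0r mule_gt0// moment_dotr_gt0.
pose V x := (dotr c x - m) / a.
have mV : measurable_fun [set: 'rV[R]_n] V.
  apply: measurable_funM => //; apply: measurable_funB => //.
  exact: measurable_dotr.
pose f x := half_power r (V x).
pose g x := half_power r (1 - V x).
have mf : measurable_fun [set: 'rV[R]_n] f.
  exact: (measurableT_comp (measurable_half_power r)).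
have mg : measurable_fun [set: 'rV[R]_n] g.
  apply: (measurableT_comp (measurable_half_power r)).
  exact: measurable_funB.
have shiftE w : V (shift_rV X z w) = V (X w) + 1.
  by rewrite /V /shift_rV dotrDr -/a; field.
(* The hyperplane is the set where [V = 1/2]. *)
have fg_gt1 (Y : {RV P >-> 'rV[R]_n}) :
    P [set w | dotr c (Y w) = m + a / 2] = 0%E ->
    {ae distribution P Y, forall x, 1 < f x + g x}.
  move=> Y0; exists [set x | dotr c x = m + a / 2]; split => //.
    exact: measurable_hyperplane.
  move=> x /=; apply: contra_notP => xm; apply: half_power_sum_gt1 => //.
  apply/eqP => Vx; apply: xm; move: Vx; rewrite /V => /(canRL (divfK a0)).
  lra.
have powE w : `|a| `^ r * (f (X w) + g (shift_rV X z w)) =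
    2 `^ (r - 1) * `|dotr c (X w) - m| `^ r.
  rewrite /f /g shiftE (_ : 1 - (V (X w) + 1) = - V (X w)); last by ring.
  rewrite half_powerDN// mulrCA -powRM//; congr (_ * _ `^ r).
  by rewrite -normrM /V mulrC divfK.
have intE : ((`|a| `^ r)%:E * (\int[distribution P X]_x (f x)%:E +
      \int[distribution P (shift_rV X z)]_x (g x)%:E) =
    (2 `^ (r - 1))%:E * \int[P]_w (`|dotr c (X w) - m| `^ r)%:E)%E.
  rewrite !ge0_integral_distribution//; last 4 first.
  - exact/measurable_EFinP.
  - by move=> x; rewrite lee_fin half_power_ge0.
  - exact/measurable_EFinP.
  - by move=> x; rewrite lee_fin half_power_ge0.
  rewrite -ge0_integralD//; last 4 first.
  - by move=> x _; rewrite lee_fin half_power_ge0.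
  - by apply/measurable_EFinP; exact: measurableT_comp.
  - by move=> x _; rewrite lee_fin half_power_ge0.
  - by apply/measurable_EFinP; exact: measurableT_comp.
  rewrite -[RHS]ge0_integralZl_EFin ?powR_ge0//; last first.
    exact/measurable_EFinP/measurable_moment.
  rewrite -ge0_integralZl_EFin ?powR_ge0//; last 2 first.
  - by move=> w _; rewrite -EFinD lee_fin addr_ge0// half_power_ge0.
  - apply/measurable_EFinP; apply: measurable_funD; exact: measurableT_comp.
  by apply: eq_integral => w _ /=; rewrite -EFinD -!EFinM powE.
have ar0 : 0 < `|a| `^ r by rewrite powR_gt0 ?normr_gt0.
rewrite -intE EFinM lte_pmul2l ?lte_fin//.
apply: tv_dist_lt => //.
- by move=> x; exact: half_power_ge0.
- by move=> x; exact: half_power_ge0.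
- by apply: fg_gt1; exact: has_density_hyperplane.
- apply: fg_gt1; rewrite -[RHS](has_density_hyperplane (m + a / 2 - a) c0).
  congr (P _); apply/seteqP; split=> w /=; rewrite /shift_rV dotrDr -/a; lra.
- rewrite -(@lte_pmul2l _ (`|a| `^ r)%:E) ?lte_fin// mule0 intE.
  by rewrite mule_gt0// moment_dotr_gt0.
Qed.

End shifted_vector.

Theorem corollaryA2 (R : realType) (d : nat) (hd : (1 <= d)%N)
    (dO : measure_display) (Omega : measurableType dO) (P : probability Omega R)
    (X0 : {RV P >-> 'rV[R]_d}) (hX0 : has_density (distribution P X0))
    (r : R) (hr : 2 <= r) :
  (forall z m : 'rV[R]_d,
    ((enorm z `^ r
        * (1 - tv_dist (distribution P X0) (distribution P (shift_rV X0 z))))%:E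
     < (2 `^ (r - 1))%:E * 'E_P[fun w => (enorm (X0 w - m) `^ r)%R])%E) /\
  (forall z c : 'rV[R]_d, c != 0 -> forall m : R,
    ((`|dotr c z| `^ r
        * (1 - tv_dist (distribution P X0) (distribution P (shift_rV X0 z))))%:E
     < (2 `^ (r - 1))%:E * 'E_P[fun w => (`|dotr c (X0 w) - m| `^ r)%R])%E).
Proof.
split=> [z m|z c c0 m]; last exact: tv_dist_shift_dotr_lt.
case: d hd X0 hX0 z m => // n _ X0 hX0 z m.
have [c [c1 cz]] := unit_dotr_enorm z.
have c0 : c != 0 by rewrite -dotr_eq0 c1 oner_eq0.
rewrite -cz; apply: lt_le_trans (tv_dist_shift_dotr_lt hX0 z (dotr c m) hr c0) _.
rewrite lee_wpmul2l ?lee_fin ?powR_ge0// unlock.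
have mY i : measurable_fun [set: Omega] (fun w => (X0 w - m) ord0 i).
  under eq_fun do rewrite !mxE.
  apply: measurable_funB => //.
  exact: (measurableT_comp (@measurable_coord R _ i)).
apply: ge0_le_integral => //.
- exact/measurable_EFinP/measurable_moment.
- apply/measurable_EFinP; apply: (measurableT_comp (measurable_powR r)).
  under eq_fun do rewrite /enorm -powR12_sqrt ?dotr_ge0//.
  apply: (measurableT_comp (measurable_powR _)).
  by apply: measurable_sum => i; exact: measurable_funM.
move=> w _; rewrite lee_fin ge0_ler_powR ?nnegrE ?sqrtr_ge0//; first lra.
have := normr_dotr_unit (X0 w - m) c1; rewrite dotrDr -scaleN1r dotrZr.
by rewrite mulN1r.
Qed.
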